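(* Let $n \geq 3$ be an integer and let $I_n = \{(i,j) : 1 \leq i < j \leq n\}$. The map $\phi_n : \mathsf{hypo}_n \to \prod_{I_n} \mathsf{hypo}_2$ whose $(i,j)$-th component, for $(i,j) \in I_n$, is given by $[w]_{\mathsf{hypo}} \mapsto \varphi_{ij}([w]_{\mathsf{hypo}})$ ($w \in \mathcal{A}_n^*$), is an embedding (injective monoid homomorphism).
   Context: Let $\mathcal{A} = \{1<2<3<\cdots\}$ be the ordered alphabet of positive integers and $\mathcal{A}_n = \{1<\cdots<n\}$. For a word $w$, $|w|_a$ is the number of occurrences of the letter $a$; the content of $w$ is the tuple $(|w|_a)_a$, and the support $\mathrm{supp}(w)$ is the set of letters occurring in $w$. A quasi-ribbon tableau is a finite grid of cells, aligned so that the leftmost cell in each row is below the rightmost cell of the previous row, filled with letters of $\mathcal{A}$ so that rows weakly increase from left to right and columns strictly increase from top to bottom. Krob--Thibon insertion of a letter $a$ into a quasi-ribbon tableau $T$: if no entry of $T$ is $\le a$, create a new cell $a$ and glue $T$ by its top-leftmost entry to the bottom of this cell; otherwise, let $x$ be the right-most and bottom-most entry of $T$ with $x \le a$, separate $T$ just after $x$, put a new entry $a$ to the right of $x$ and glue the remaining part of $T$ (below and to the right of $x$) onto the bottom of the new entry $a$. For $u \in \mathcal{A}^*$, $\mathrm{P}_{\mathsf{hypo}}(u)$ is the tableau obtained from the empty tableau by inserting the letters of $u$ from left to right. The hypoplactic congruence is: $u \equiv_{\mathsf{hypo}} v$ iff $\mathrm{P}_{\mathsf{hypo}}(u) = \mathrm{P}_{\mathsf{hypo}}(v)$.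 The hypoplactic monoid is $\mathsf{hypo} = \mathcal{A}^*/{\equiv_{\mathsf{hypo}}}$, and the hypoplactic monoid of rank $n$ is $\mathsf{hypo}_n = \mathcal{A}_n^*/{\equiv_{\mathsf{hypo}}}$, a submonoid of $\mathsf{hypo}$; classes are written $[u]_{\mathsf{hypo}}$, $[u]_{\mathsf{hypo}_n}$. Known equivalent description (Novelli): $u \equiv_{\mathsf{hypo}} v$ iff $u$ and $v$ have the same content and the same inversions, where, if $\mathrm{supp}(u) = \{a_1<\dots<a_k\}$, $u$ has an $a_{i+1}$-$a_i$ inversion ($1 \le i \le k-1$) iff $a_{i+1}a_i$ is a (scattered) subsequence of $u$. For $i<j$ in $\mathcal{A}$, let $\varphi_{ij}: \mathcal{A}^* \to \mathsf{hypo}_2$ be the monoid homomorphism with $\varphi_{ij}(i) = [1]_{\mathsf{hypo}_2}$, $\varphi_{ij}(j) = [2]_{\mathsf{hypo}_2}$, $\varphi_{ij}(a) = [21]_{\mathsf{hypo}_2}$ if $i<a<j$, and $\varphi_{ij}(a) = [\varepsilon]_{\mathsf{hypo}_2}$ otherwise ($\varepsilon$ is the empty word). It factors through $\equiv_{\mathsf{hypo}}$ to a homomorphism $\mathsf{hypo} \to \mathsf{hypo}_2$, also denoted $\varphi_{ij}$. *)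

(* Defs.v *)
From HB Require Import structures.
From mathcomp Require Import all_boot all_order.

Set Implicit Arguments.
Unset Strict Implicit.
Unset Printing Implicit Defensive.

Import Order.TTheory.

Local Open Scope order_scope.
Local Open Scope group_scope.

Section Tableaux.
Variables (d : Order.disp_t) (A : orderType d).
Implicit Types (a b x y z : A) (u v w s : seq A) (r : seq A) (t : seq (seq A)).

(* A quasi-ribbon tableau is given by its rows, from top to bottom. Since the
   first cell of each row lies just below the last cell of the previous one,
   these are the only vertically adjacent cells. *)
Definition glued r r' := if r' is y :: _ then last y r < y else false.

Definition quasi_ribbon t :=
  all (fun r => (r != [::]) && sorted <=%O r) t && sorted glued t.

(* Krob--Thibon insertion. The entries of a quasi-ribbon tableau increase weakly
   when read row by row, so the last row having an entry <= a contains the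
   rightmost and bottommost such entry x, and in this row the entries <= a are
   those up to x. If t has no entry <= a, the recursion stops at the top row,
   the first filter is empty, and the new row [:: a] is put on top of t. *)
Fixpoint insert t a : seq (seq A) :=
  if t is r :: t' then
    if has (has (fun x => x <= a)) t' then r :: insert t' a
    else rcons [seq x <- r | x <= a] a ::
         (if [seq x <- r | a < x] is y :: r' then (y :: r') :: t' else t')
  else [:: [:: a]].

Definition P_hypo w : seq (seq A) := foldl insert [::] w.

Definition hypo_eq u v := P_hypo u == P_hypo v.

(* The inversions of Novelli's description of the congruence are the
   [has_inv u x y] where x < y are consecutive letters of the support of u. *)
Definition has_inv u x y := (x < y) && subseq [:: y; x] u.

Definition consecutive u x y :=
  [&& x \in u, y \in u, x < y & all (fun z => (z <= x) || (y <= z)) u].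

Definition conshd x t := if t is r :: t' then (x :: r) :: t' else [:: [:: x]].

Fixpoint cut (e : rel A) s : seq (seq A) :=
  if s is x :: s' then
    if s' is y :: _ then
      if e x y then [:: x] :: cut e s' else conshd x (cut e s')
    else [:: [:: x]]
  else [::].

Lemma cut_shape e y s : exists r t, cut e (y :: s) = (y :: r) :: t.
Proof.
elim: s y => [|z s IHs] y; first by exists [::], [::].
rewrite /=; case: ifP => _; first by do 2!eexists.
by have /= [r [t ->]] := IHs z; do 2!eexists.
Qed.

Lemma cutE e x y s : cut e (x :: y :: s) =
  if e x y then [:: x] :: cut e (y :: s) else conshd x (cut e (y :: s)).
Proof. by []. Qed.

Lemma flatten_cut e s : flatten (cut e s) = s.
Proof.
elim: s => [|x [|y s] IHs] //.
have [r [t E]] := cut_shape e y s.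
rewrite cutE E; rewrite E in IHs; case: IHs => /= IHs.
by case: ifP => _ /=; rewrite IHs.
Qed.

Lemma eq_cut e f s :
  (forall p x y q, s = p ++ x :: y :: q -> e x y = f x y) -> cut e s = cut f s.
Proof.
elim: s => [|x [|y s] IHs] // H.
rewrite !cutE (H [::] x y s) // IHs // => p x' y' q E.
by apply: (H (x :: p) _ _ q); rewrite E.
Qed.

Lemma cut_behead e f x y s : cut e (x :: y :: s) = cut f (x :: y :: s) ->
  e x y = f x y /\ cut e (y :: s) = cut f (y :: s).
Proof.
rewrite !cutE.
have [r [t ->]] := cut_shape e y s; have [r' [t' ->]] := cut_shape f y s.
by case: ifP => _; case: ifP => _ //= [] -> ->.
Qed.

Lemma cut_inj e f p x y q :
  cut e (p ++ x :: y :: q) = cut f (p ++ x :: y :: q) -> e x y = f x y.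
Proof.
elim: p => [|z [|z' p] IHp]; first by move/cut_behead => [].
  by move/cut_behead => [_ /IHp].
by move/cut_behead => [_ /IHp].
Qed.

Lemma insertE r t a : insert (r :: t) a =
  if has (has (fun x => x <= a)) t then r :: insert t a
  else rcons [seq x <- r | x <= a] a ::
       (if [seq x <- r | a < x] is y :: r' then (y :: r') :: t else t).
Proof. by []. Qed.

Lemma insert_cut e f a s : sorted <=%O s ->
  {in s &, forall x y, (y <= a) || (a < x) -> f x y = e x y} ->
  {in s, forall x, x <= a ->
    {in s, forall y, y <= a -> y <= x} -> ~~ f x a} ->
  {in s, forall y, a < y -> f a y} ->
  insert (cut e s) a =
  cut f ([seq x <- s | x <= a] ++ a :: [seq x <- s | a < x]).
Proof.
elim: s => [|x s IHs] // sxs Hfe Hxa Hay.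
have ss := path_sorted sxs.
have {}IHs : insert (cut e s) a =
  cut f ([seq x <- s | x <= a] ++ a :: [seq x <- s | a < x]).
  apply: IHs => // [y z ys zs|y ys|y ys].
  - by apply: Hfe; rewrite inE ?ys ?zs orbT.
  - move=> ya Hy; apply: Hxa => //; first by rewrite inE ys orbT.
    move=> z; rewrite inE => /predU1P[-> _|]; last exact: Hy.
    by move: sxs; rewrite /= path_sortedE => [/andP[/allP ->]|]; last exact: le_trans.
  - by apply: Hay; rewrite inE ys orbT.
have gts b : a < b -> path <=%O b s -> all (fun x => a < x) s.
  move=> ab; rewrite path_sortedE; last exact: le_trans.
  by case/andP => /allP H _; apply/allP => z /H; apply: lt_le_trans.
have gt0 s' : all (fun x => a < x) s' -> [seq x <- s' | x <= a] = [::].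
  by move=> H; apply/eqP; rewrite -(negbK (_ == _)) -has_filter -all_predC;
     apply: sub_all H => z /=; rewrite ltNge.
have gt1 s' : all (fun x => a < x) s' -> [seq x <- s' | a < x] = s'.
  by move/all_filterP.
have gt2 s' t : all (fun x => a < x) s' -> flatten t = s' ->
    has (has (fun x => x <= a)) t = false.
  move=> H E; apply/negbTE; rewrite -all_predC; apply/allP => r rt /=.
  rewrite -all_predC; apply/allP => z zr /=; rewrite -ltNge.
  by apply: (allP H); rewrite -E; apply/flattenP; exists r.
case: (leP x a) => [xa|ax]; last first.
  have as_ : all (fun x => a < x) (x :: s) by rewrite /= ax (gts x).
  rewrite gt0 ?gt1 // cat0s cutE Hay ?mem_head //.
  have -> : cut f (x :: s) = cut e (x :: s).
    apply: eq_cut => p y z q E; apply: Hfe; rewrite ?E.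
    - by rewrite mem_cat mem_head orbT.
    - by rewrite mem_cat !inE eqxx !orbT.
    - by rewrite (allP as_ y) ?orbT // E mem_cat mem_head orbT.
  have [r [t E]] := cut_shape e x s.
  have Efl := flatten_cut e (x :: s); rewrite E in Efl.
  have aH : all (fun x => a < x) (x :: r).
    by move: as_; rewrite -Efl [flatten _]/= -cat_cons all_cat => /andP[].
  have Ht : has (has (fun x => x <= a)) t = false.
    by have /negbT /norP [_ /negbTE] := gt2 _ _ as_ Efl.
  rewrite E insertE Ht.
  by rewrite gt0 // gt1.
rewrite [filter _ (x :: s)]/= xa [filter (fun y => a < y) (x :: s)]/= ltNge xa.
rewrite [~~ true]/=.
case: s => [|y s] in sxs ss Hfe Hxa Hay IHs gts *.
  rewrite /= xa ltNge xa /= (negbTE (Hxa x _ xa _)) ?mem_head //.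
  by move=> y; rewrite inE => /eqP->.
have [r [t E]] := cut_shape e y s.
have Efl := flatten_cut e (y :: s); rewrite E in Efl.
rewrite cutE; case: (leP y a) => [ya|ay].
  move: IHs; rewrite [filter _ (y :: s)]/= ya [filter (fun z => a < z) (y :: s)]/=.
  rewrite ltNge ya [~~ true]/= !cat_cons cutE => <-.
  rewrite Hfe ?ya ?inE ?eqxx ?orbT //; case: ifP => exy.
    by rewrite E insertE [has _ (_ :: _)]/= ya.
  rewrite E [conshd x _]/= !insertE; case: ifP => // _.
  by rewrite /= xa ltNge xa ya ltNge ya.
have as_ : all (fun x => a < x) (y :: s).
  by move: ss; rewrite /= ay path_sortedE => [/andP[/allP H _]|]; last exact: le_trans;
     apply/allP => z /H; apply: lt_le_trans.
have Efe : cut f (y :: s) = (y :: r) :: t.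
  rewrite -E; apply: eq_cut => p x' y' q E'; apply: Hfe.
  - by rewrite inE E' mem_cat mem_head !orbT.
  - by rewrite inE E' mem_cat !inE eqxx !orbT.
  - by rewrite (allP as_ x') ?orbT // E' mem_cat mem_head orbT.
have Hn := gt2 _ _ as_ Efl.
have Ht : has (has (fun x => x <= a)) t = false.
  by have /negbT /norP [_ /negbTE] := Hn.
have aH : all (fun x => a < x) (y :: r).
  by move: as_; rewrite -Efl [flatten _]/= -cat_cons all_cat => /andP[].
have Hx : ~~ f x a.
  apply: Hxa => //; first exact: mem_head.
  move=> z; rewrite inE => /predU1P[->|/(allP as_)] //.
  by rewrite ltNge => /negbTE->.
rewrite gt0 // gt1 // !(cat_cons, cat0s) !cutE (negbTE Hx).
rewrite Hay ?inE ?eqxx ?orbT // Efe E; case: ifP => _.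
  by rewrite insertE Hn /= xa ltNge xa.
rewrite insertE Ht.
have := gt0 _ aH; have := gt1 _ aH.
by rewrite /= (leNgt y a) ay xa (ltNge a x) xa /= => -> ->.
Qed.

Lemma subseq2_cat x y u v : subseq [:: y; x] (u ++ v) =
  [|| subseq [:: y; x] u, (y \in u) && (x \in v) | subseq [:: y; x] v].
Proof.
elim: u => [|z u IHu] //; rewrite cat_cons inE.
have E w : subseq [:: y; x] (z :: w) =
    if y == z then x \in w else subseq [:: y; x] w.
  by rewrite -sub1seq /=; case: eqP.
rewrite !E {}IHu; case: eqP => [->|_] //=; rewrite mem_cat.
congr (_ || _); case: (boolP (x \in v)) => //= /negP xv.
apply/esym/negP => /mem_subseq sv; apply: xv; apply: sv.
by rewrite !inE eqxx orbT.
Qed.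

Lemma inv_cat u v x y :
  has_inv (u ++ v) x y = [|| has_inv u x y, [&& x < y, y \in u & x \in v] | has_inv v x y].
Proof. by rewrite /has_inv subseq2_cat; case: (x < y). Qed.

Lemma inv_mem u x y : has_inv u x y -> [/\ x < y, x \in u & y \in u].
Proof.
case/andP=> xy /mem_subseq sv; split=> //; apply: sv; rewrite !inE eqxx //.
by rewrite orbT.
Qed.

Lemma sorted_cat_le a s1 s2 : sorted <=%O s1 -> sorted <=%O s2 ->
  {in s1, forall x, x <= a} -> {in s2, forall x, a <= x} ->
  sorted <=%O (s1 ++ s2).
Proof.
rewrite !(sorted_pairwise le_trans) pairwise_cat => -> -> H1 H2.
rewrite !andbT; apply/allrelP => x y /H1 xa /H2; exact: le_trans.
Qed.

Lemma sorted_split a s : sorted <=%O s ->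
  s = [seq x <- s | x <= a] ++ [seq x <- s | a < x].
Proof.
move=> ss; apply: (sorted_eq le_trans le_anti) => //.
  apply: (@sorted_cat_le a) => //; try exact: (sorted_filter le_trans).
    by move=> x; rewrite mem_filter => /andP[].
  by move=> x; rewrite mem_filter => /andP[/ltW].
have /eq_filter -> : (fun x => a < x) =1 predC (fun x => x <= a).
  by move=> x /=; rewrite ltNge.
by rewrite perm_sym perm_filterC.
Qed.

Lemma P_hypoE u : P_hypo u = cut (has_inv u) (sort <=%O u).
Proof.
elim/last_ind: u => [|u a IHu] //.
rewrite /P_hypo -cats1 foldl_cat /= -/(P_hypo u) IHu.
have memu := mem_sort <=%O u.
have inva z y : has_inv [:: a] z y = false.
  apply/negP => /inv_mem[zy]; rewrite !inE => /eqP Ez /eqP Ey.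
  by rewrite Ez Ey ltxx in zy.
rewrite (insert_cut (f := has_inv (u ++ [:: a]))) ?sort_le_sorted //.
- congr cut; apply: (sorted_eq le_trans le_anti).
  + apply: (@sorted_cat_le a).
    * by apply: (sorted_filter le_trans); apply: sort_le_sorted.
    * rewrite (sorted_pairwise le_trans) /=; apply/andP; split.
        by apply/allP=> x; rewrite mem_filter => /andP[/ltW].
      rewrite -(sorted_pairwise le_trans).
      by apply: (sorted_filter le_trans); apply: sort_le_sorted.
    * by move=> x; rewrite mem_filter => /andP[].
    * by move=> x; rewrite inE mem_filter => /predU1P[->|/andP[/ltW]].
  + exact: sort_le_sorted.
  + rewrite perm_sym perm_sort perm_sym -cat1s perm_catCA perm_sym perm_catC.
    rewrite perm_cat2l -(sorted_split a) ?sort_le_sorted //.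
    by rewrite perm_sym perm_sort.
- move=> x y _ _ H; rewrite inv_cat inva orbF inE.
  case: eqP => [Exa|_]; last by rewrite !andbF orbF.
  by move: H; rewrite Exa ltxx orbF => /le_gtF ->; rewrite orbF.
- move=> x; rewrite memu => xu xa Hx; rewrite inv_cat inva orbF inE.
  rewrite negb_or; apply/andP; split.
    apply/negP => /inv_mem [xa' _ au].
    by have := Hx a; rewrite memu au lexx leNgt xa' => /(_ isT isT).
  by apply/negP => /and3P[+ _ /eqP E]; rewrite E ltxx.
- move=> y; rewrite memu => yu ay; rewrite inv_cat inva orbF inE.
  by rewrite eqxx ay yu orbT.
Qed.

Lemma mem_P_hypo u v : hypo_eq u v -> perm_eq u v.
Proof.
rewrite /hypo_eq !P_hypoE => /eqP /(congr1 flatten).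
by rewrite !flatten_cut => E; rewrite -(perm_sort <=%O u) E perm_sort.
Qed.

Lemma consecutive_sort u x y : consecutive u x y ->
  exists p q, sort <=%O u = p ++ x :: y :: q.
Proof.
case/and4P=> xu yu xy /allP cxy.
have ss := sort_le_sorted u; have E := sorted_split x ss.
have memu := mem_sort <=%O u.
case/lastP E1 : [seq z <- sort <=%O u | z <= x] => [|p x'].
  have : x \in [seq z <- sort <=%O u | z <= x] by rewrite mem_filter lexx memu.
  by rewrite E1.
case E2 : [seq z <- sort <=%O u | x < z] => [|y' q].
  have : y \in [seq z <- sort <=%O u | x < z] by rewrite mem_filter xy memu.
  by rewrite E2.
exists p, q; rewrite E E1 E2 cat_rcons.
have /andP[x'x x'u] : (x' <= x) && (x' \in u).
  have : x' \in rcons p x' by rewrite mem_rcons mem_head.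
  by rewrite -E1 mem_filter memu.
have /andP[xy' y'u] : (x < y') && (y' \in u).
  have : y' \in y' :: q by rewrite mem_head.
  by rewrite -E2 mem_filter memu.
have -> : x' = x.
  apply/le_anti; rewrite x'x /=.
  have : x \in [seq z <- sort <=%O u | z <= x] by rewrite mem_filter lexx memu.
  rewrite E1 mem_rcons inE => /predU1P[->//|xp].
  have := sorted_filter le_trans (fun z => z <= x) ss.
  rewrite E1 (sorted_pairwise le_trans) -cats1 pairwise_cat => /andP[/allrelP + _].
  by apply; rewrite ?mem_head.
have -> // : y' = y.
apply/le_anti; have := cxy _ y'u; rewrite leNgt xy' /= => ->; rewrite andbT.
have : y \in [seq z <- sort <=%O u | x < z] by rewrite mem_filter xy memu.
rewrite E2 inE => /predU1P[->//|yq].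
have := sorted_filter le_trans (fun z => x < z) ss.
by rewrite E2 (sorted_pairwise le_trans) /= => /andP[/allP + _]; apply.
Qed.

Lemma sort_consecutive u p x y q : sort <=%O u = p ++ x :: y :: q ->
  x < y -> consecutive u x y.
Proof.
move=> E xy; have memu := mem_sort <=%O u; apply/and4P; split => //.
- by rewrite -memu E mem_cat mem_head orbT.
- by rewrite -memu E mem_cat !inE eqxx !orbT.
apply/allP => z; rewrite -memu.
have := sort_le_sorted u; rewrite E (sorted_pairwise le_trans) pairwise_cat.
case/and3P=> /allrelP H _ /= /and3P [_ /allP H' _].
rewrite mem_cat !inE => /orP[zp|/or3P[/eqP->|/eqP->|/H' ->]].
- by rewrite H ?mem_head.
- by rewrite lexx.
- by rewrite lexx orbT.
- by rewrite orbT.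
Qed.

Theorem Novelli u v : hypo_eq u v <->
  perm_eq u v /\ (forall x y, consecutive u x y -> has_inv u x y = has_inv v x y).
Proof.
split=> [uv|[/(perm_sort_leP _ _) Es H]].
  have puv := mem_P_hypo uv; split=> // x y /consecutive_sort[p [q E]].
  move: uv; rewrite /hypo_eq !P_hypoE.
  have <- : sort <=%O u = sort <=%O v by apply/perm_sort_leP.
  by rewrite E => /eqP/cut_inj.
rewrite /hypo_eq !P_hypoE -Es; apply/eqP/eq_cut => p x y q E.
case: (boolP (x < y)) => xy; last by rewrite /has_inv (negbTE xy).
exact/H/(sort_consecutive E).
Qed.

Lemma P_hypo_quasi_ribbon u : quasi_ribbon (P_hypo u).
Proof.
rewrite P_hypoE; have := sort_le_sorted u.
have : subrel (has_inv u) <%O by move=> x y /andP[].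
elim: (sort _ u) => [|x [|y s] IHs] // He sxs.
have {IHs} := IHs He (path_sorted sxs).
have [r [t E]] := cut_shape (has_inv u) y s.
rewrite cutE E; move: sxs => /andP[xy _]; case: ifP => [/He exy|_].
  by rewrite /quasi_ribbon /= exy.
by rewrite /quasi_ribbon /= xy; case: t {E}.
Qed.

Lemma hypo_eq_refl : reflexive hypo_eq. Proof. by move=> u; exact: eqxx. Qed.
Lemma hypo_eq_sym : symmetric hypo_eq. Proof. by move=> u v; exact: eq_sym. Qed.
Lemma hypo_eq_trans : transitive hypo_eq.
Proof. by move=> v u w /eqP uv /eqP vw; apply/eqP; rewrite uv. Qed.

Canonical hypo_equiv := EquivRel hypo_eq hypo_eq_refl hypo_eq_sym hypo_eq_trans.

Lemma hypo_eq_cat u u' v v' :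
  hypo_eq u u' -> hypo_eq v v' -> hypo_eq (u ++ v) (u' ++ v').
Proof.
move=> uu' vv'; apply: (@hypo_eq_trans (u' ++ v)).
  by rewrite /hypo_eq /P_hypo !foldl_cat; move/eqP: uu' => uu'; rewrite -!/(P_hypo _) uu'.
have [pv iv] := iffLR (Novelli v v') vv'.
apply/Novelli; split=> [|x y /and4P[xuv yuv xy]]; first by rewrite perm_cat2l.
rewrite all_cat => /andP[_ cv]; rewrite !inv_cat (perm_mem pv).
case: (boolP (has_inv u' x y)) => //= _.
case: (boolP (consecutive v x y)) => [/iv->//|].
rewrite /consecutive xy cv !andbT negb_and.
have H w : perm_eq v w -> (x \notin v) || (y \notin v) -> has_inv w x y = false.
  move=> pw nxy; apply/negP => /inv_mem[_]; rewrite -!(perm_mem pw) => xv yv.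
  by rewrite xv yv in nxy.
by move=> nxy; rewrite !H.
Qed.

Local Open Scope quotient_scope.

Definition hypoplactic : Type := {eq_quot hypo_eq}.
HB.instance Definition _ : EqQuotient _ hypo_eq hypoplactic :=
  EqQuotient.on hypoplactic.
HB.instance Definition _ := Choice.on hypoplactic.

Definition hypo_mul : hypoplactic -> hypoplactic -> hypoplactic :=
  fun p q => \pi_hypoplactic (repr p ++ repr q).
Definition hypo_one : hypoplactic := \pi_hypoplactic [::].

Lemma pi_cat u v : \pi_hypoplactic (u ++ v) =
  hypo_mul (\pi_hypoplactic u) (\pi_hypoplactic v).
Proof.
by apply/eqmodP/hypo_eq_cat; apply/eqmodP; rewrite reprK.
Qed.

Lemma hypo_mulA : associative hypo_mul.
Proof.
move=> x y z; elim/quotW: x=> u; elim/quotW: y=> v; elim/quotW: z=> w.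
by rewrite -(pi_cat v w) -(pi_cat u v) -(pi_cat u) -(pi_cat (u ++ v)) catA.
Qed.

Lemma hypo_mul1 : left_id hypo_one hypo_mul.
Proof. by move=> x; elim/quotW: x => u; rewrite -pi_cat. Qed.

Lemma hypo_mulr1 : right_id hypo_one hypo_mul.
Proof. by move=> x; elim/quotW: x => u; rewrite -pi_cat cats0. Qed.

HB.instance Definition _ :=
  isMonoid.Build hypoplactic hypo_mulA hypo_mul1 hypo_mulr1.

End Tableaux.

Local Open Scope quotient_scope.

(* The alphabet {1 < ... < n}, with the order of the integers. Insertion only
   compares letters, so the congruence on its words is the restriction of the
   congruence on the words over all positive integers. *)
Definition letter n := {a : 'I_n.+1 | (0 < a)%N}.
HB.instance Definition _ n := SubFinite.on (letter n).
HB.instance Definition _ n := [Order of letter n by <:].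

Notation hypo n := (hypoplactic (letter n)).

Definition letter1 : letter 2 := exist _ (@Ordinal 3 1 isT) isT.
Definition letter2 : letter 2 := exist _ (@Ordinal 3 2 isT) isT.

Section Varphi.
(* A is any totally ordered alphabet: for {1 < ... < n} this is the restriction
   of the homomorphism defined on words over the positive integers. *)
Variables (d : Order.disp_t) (A : orderType d).
Implicit Types (i j a : A) (u v w : seq A).

Definition varphi_letter i j a : seq (letter 2) :=
  if a == i then [:: letter1]
  else if a == j then [:: letter2]
  else if i < a < j then [:: letter2; letter1]
  else [::].

Definition varphi_word i j w : hypo 2 :=
  \prod_(a <- w) \pi_(hypo 2) (varphi_letter i j a).

(* Independent of the representative when i < j, see [varphiE]. *)
Definition varphi i j (x : hypoplactic A) : hypo 2 := varphi_word i j (repr x).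

Lemma piM (d' : Order.disp_t) (B : orderType d') (s t : seq B) :
  \pi_(hypoplactic B) (s ++ t) =
  \pi_(hypoplactic B) s * \pi_(hypoplactic B) t.
Proof. exact: pi_cat. Qed.

Lemma varphi_wordE i j w :
  varphi_word i j w = \pi_(hypo 2) (flatten (map (varphi_letter i j) w)).
Proof.
rewrite /varphi_word; elim: w => [|a w IHw]; first by rewrite big_nil.
by rewrite big_cons IHw /= piM.
Qed.

Lemma letter2P (x : letter 2) : x = letter1 \/ x = letter2.
Proof.
by case: x => -[[|[|[|//]]] ltx] x0 //; [left | right]; do 2!apply: val_inj.
Qed.

Lemma letter1_img i j w : i < j ->
  (letter1 \in flatten (map (varphi_letter i j) w)) =
  (i \in w) || has (fun a => i < a < j) w.
Proof.
move=> ij; elim: w => //= a w IHw; rewrite mem_cat inE IHw /varphi_letter.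
case: (eqVneq a i) => [->|ai] /=; first by rewrite ?inE ?eqxx.
case: (eqVneq a j) => [->|aj].
  by rewrite ltxx andbF.
by case: ifP => /= _; rewrite ?orbT.
Qed.

Lemma letter21_img i j w : i < j ->
  subseq [:: letter2; letter1] (flatten (map (varphi_letter i j) w)) =
  subseq [:: j; i] w || has (fun a => i < a < j) w.
Proof.
move=> ij; elim: w => // a w IHw.
rewrite [map _ _]/= [flatten _]/= subseq2_cat IHw letter1_img //.
rewrite -[a :: w]cat1s subseq2_cat has_cat /varphi_letter inE.
rewrite (_ : subseq [:: j; i] [:: a] = false); last by rewrite /=; case: ifP.
rewrite (eq_sym j a); case: (eqVneq a i) => [->|ai] /=.
  by rewrite ltxx (lt_eqF ij).
case: (eqVneq a j) => [->|aj] /=.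
  rewrite ltxx andbF /=.
  by case: (i \in w); case: (subseq _ _); case: (has _ _).
by case: ifP => /= _; rewrite ?orbT.
Qed.

Lemma hypo_eq_img i j u v : i < j -> hypo_eq u v ->
  hypo_eq (flatten (map (varphi_letter i j) u))
          (flatten (map (varphi_letter i j) v)).
Proof.
move=> ij /Novelli[puv iuv]; apply/Novelli; split.
  by apply: perm_flatten; apply: perm_map.
move=> x y /and4P[_ _ xy _].
have [-> ->] : x = letter1 /\ y = letter2.
  by case: (letter2P x) (letter2P y) xy => -> [] ->.
rewrite /has_inv !letter21_img // -(perm_has _ puv) /=.
case: (boolP (has _ u)) => [|/hasPn nb]; rewrite ?orbT // !orbF.
have sE w : subseq [:: j; i] w = has_inv w i j by rewrite /has_inv ij.
rewrite !sE; case: (boolP (consecutive u i j)) => [/iuv //|].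
have -> : consecutive u i j = (i \in u) && (j \in u).
  rewrite /consecutive ij; case: (i \in u); case: (j \in u) => //=.
  by apply/allP => a /nb; rewrite negb_and -!leNgt.
have F w : perm_eq u w -> ~~ ((i \in u) && (j \in u)) -> has_inv w i j = false.
  by move=> uw; apply: contraNF => /inv_mem[_]; rewrite -!(perm_mem uw) => -> ->.
by move=> nij; rewrite !F.
Qed.

Lemma varphiE i j w : i < j -> varphi i j (\pi w) = varphi_word i j w.
Proof.
move=> ij; rewrite /varphi !varphi_wordE; apply/eqmodP/hypo_eq_img => //.
by apply/eqmodP; rewrite reprK.
Qed.

End Varphi.

Definition index_pair n := {p : letter n * letter n | p.1 < p.2}.
HB.instance Definition _ n := SubFinite.on (index_pair n).

Definition phi n (x : hypo n) : {ffun index_pair n -> hypo 2} :=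
  [ffun p => varphi (val p).1 (val p).2 x].

(* Main.v *)
Require Import Defs.
From mathcomp Require Import all_boot all_order.

(* The multiplicity of a letter in w can be read off phi_ij at a pair (i, j) of
   neighbouring letters of the alphabet, since no letter is then sent to 21. Once
   the contents agree, the inversions between consecutive letters i < j of the
   support are those of phi_ij, since no letter of the word is sent to 21. *)

Import Order.TTheory.
Local Open Scope order_scope.
Local Open Scope quotient_scope.

Section Varphi.
Variables (d : Order.disp_t) (A : orderType d).
Implicit Types (i j a : A) (u v w : seq A).

Lemma varphi_mul i j (x y : hypoplactic A) : i < j ->
  varphi i j (x * y)%g = (varphi i j x * varphi i j y)%g.
Proof.
move=> ij; elim/quotW: x => u; elim/quotW: y => v.
by rewrite -piM !varphiE // /varphi_word big_cat.
Qed.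

Lemma varphi_one i j : i < j -> varphi i j (1%g : hypoplactic A) = 1%g.
Proof.
move=> ij; have -> : (1%g : hypoplactic A) = \pi [::] by [].
by rewrite varphiE // /varphi_word big_nil.
Qed.

Lemma varphi_eq_img i j u v : i < j ->
  varphi i j (\pi_(hypoplactic A) u) = varphi i j (\pi v) ->
  hypo_eq (flatten (map (varphi_letter i j) u))
          (flatten (map (varphi_letter i j) v)).
Proof. by move=> ij; rewrite !varphiE // !varphi_wordE => /eqmodP. Qed.

(** With no letter of the alphabet strictly between [i] and [j], a 1 in the image can only come from
    [i] and a 2 only from [j]. *)
Lemma count_img i j w : i < j -> (forall a, ~~ (i < a < j)) ->
  (count_mem letter1 (flatten (map (varphi_letter i j) w)) = count_mem i w) *
  (count_mem letter2 (flatten (map (varphi_letter i j) w)) = count_mem j w).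
Proof.
move=> ij nb; elim: w => //= a w [IH1 IH2].
rewrite !count_cat IH1 IH2 /varphi_letter (negbTE (nb a)).
case: (eqVneq a i) => [->|ai]; first by rewrite (lt_eqF ij).
by case: (eqVneq a j).
Qed.

Lemma mem_letter2_img i j w : i < j -> j \in w ->
  letter2 \in flatten (map (varphi_letter i j) w).
Proof.
move=> ij jw; apply/flatten_mapP; exists j => //.
by rewrite /varphi_letter (gt_eqF ij) eqxx mem_head.
Qed.

(** Neither word has a letter strictly between [i] and [j]: [u] by consecutiveness, [v] because it
    has the same letters. So a subsequence 21 of either image must come from [j] before [i]. *)
Lemma has_inv_img i j u v : perm_eq u v -> consecutive u i j ->
  hypo_eq (flatten (map (varphi_letter i j) u))
          (flatten (map (varphi_letter i j) v)) ->
  has_inv u i j = has_inv v i j.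
Proof.
move=> puv /and4P[iu ju ij /allP cu] /Novelli[_ /(_ letter1 letter2)].
have nb : has (fun a => i < a < j) u = false.
  apply/negbTE/hasPn => a /cu; rewrite negb_and -!leNgt //.
(* Both 1 and 2 occur in the image, and they exhaust the alphabet of rank 2. *)
have -> : consecutive (flatten (map (varphi_letter i j) u)) letter1 letter2.
  rewrite /consecutive letter1_img // iu mem_letter2_img //=.
  by apply/allP => a _; case: (letter2P a) => ->; rewrite lexx ?orbT.
move=> /(_ isT); rewrite /has_inv !letter21_img //.
by rewrite -(perm_has _ puv) nb !orbF ij.
Qed.

End Varphi.

Lemma letter_neighbour {n} (a : letter n) : (1 < n)%N ->
  exists i j : letter n,
    [/\ i < j, forall b, ~~ (i < b < j) & a = i \/ a = j].
Proof.
move=> n1; case: a => -[a an] /= a0.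
have ltE (x y : letter n) : (x < y) = (val (val x) < val (val y))%N by [].
(* The pair is [(a, a+1)] if [a < n], and [(n-1, n)] if [a = n]; in the latter case [1 < n] makes
   [n-1] a letter. *)
case: (ltnP a.+1 n.+1) => [Ha|Ha].
  exists (exist _ (Ordinal an) a0), (exist _ (Ordinal Ha) isT).
  split; [by rewrite ltE /= | | by left].
  by move=> b; rewrite !ltE /= ltnS; case: ltnP.
have an' : (a.-1 < n.+1)%N by apply: leq_ltn_trans an; exact: leq_pred.
have a0' : (0 < a.-1)%N by case: a a0 Ha {an an'} => [|[]] // _; rewrite leqNgt ltnS n1.
exists (exist _ (Ordinal an') a0'), (exist _ (Ordinal an) a0).
split; [by rewrite ltE /= ltn_predL | | by right].
by move=> b; rewrite !ltE /= prednK // ltnNge; case: (a <= _)%N.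
Qed.

Theorem proposition3p5 (n : nat) (hn : (3 <= n)%N) :
  monoid_morphism (@phi n) /\ injective (@phi n).
Proof.
split; first split.
- by apply/ffunP => -[[i j] /= ij]; rewrite !ffunE varphi_one.
- by move=> x y; apply/ffunP => -[[i j] /= ij]; rewrite !ffunE varphi_mul.
move=> x y; elim/quotW: x => u; elim/quotW: y => v /ffunP Huv.
have {}Huv (i j : letter n) : i < j ->
    hypo_eq (flatten (map (varphi_letter i j) u))
            (flatten (map (varphi_letter i j) v)).
  move=> ij; apply: varphi_eq_img => //.
  by have := Huv (exist _ (i, j) ij); rewrite !ffunE.
have puv : perm_eq u v.
  apply/allP => a _ /=.
  have [i [j [ij nb Ea]]] := letter_neighbour a (ltnW hn).
  (* Only the content half of Novelli's description is used here: the images have equally many 1s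
     and 2s, and one of these numbers counts [a]. *)
  have /Novelli[/permP E _] := Huv i j ij.
  have Ci := E (pred1 letter1); have Cj := E (pred1 letter2).
  by rewrite !count_img // in Ci Cj; case: Ea => ->; apply/eqP.
apply/eqmodP/Novelli; split => // i j cij; apply: has_inv_img => //.
by apply: Huv; case/and4P: cij.
Qed.
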